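(* Let $C[0,1]$ be the Banach space of continuous functions $f\colon[0,1]\to\mathbb{R}$ with the supremum norm. The subset $U$ of $C[0,1]$ that consists of the continuous functions with infinite (total) variation on $[0,1]$ is a $G_\delta$ comeager set in $C[0,1]$. Moreover, its complement $C[0,1]\setminus U$ is $\sigma$-porous.
   Context: Let $X$ be a metric space and let $B(x,r)$ denote the open ball with center $x\in X$ and radius $r>0$. For $E\subset X$, $x\in X$ and $R>0$ put $\gamma(x,R,E):=\sup\{r>0\colon \exists z\in X,\ B(z,r)\subset B(x,R)\setminus E\}$. The porosity of $E$ at $x$ is $p(E,x):=2\limsup_{\varepsilon\to0^+}\frac{\gamma(x,\varepsilon,E)}{\varepsilon}$. A set $E$ is porous if $p(E,x)>0$ for each $x\in E$; it is $\sigma$-porous if it is a countable union of porous sets. *)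

(* Defs.v *)
From HB Require Import structures.
From mathcomp Require Import all_boot all_order all_algebra.
From mathcomp Require Import ring.
From mathcomp Require Import all_classical all_reals all_analysis.

Set Implicit Arguments.
Unset Strict Implicit.
Unset Printing Implicit Defensive.

Import Order.TTheory GRing.Theory Num.Theory.
Import numFieldNormedType.Exports.

Local Open Scope classical_set_scope.
Local Open Scope ring_scope.

Section porosity.
Context {R : realType} {X : metricType R}.
Implicit Types (x : X) (E : set X).

(* The supremum is that of a set of nonnegative reals, in [0, +oo]: the maximum
   with 0 only matters when no ball fits (sup set0 = 0, whereas
   ereal_sup set0 = -oo). *)
Definition gamma x (r : R) E : \bar R :=
  Order.max 0%E
    (ereal_sup [set s%:E | s in [set s : R | 0 < s /\
       exists z : X, ball z s `<=` ball x r `\` E]]).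

Definition porosity E x : \bar R :=
  (2%:E * limf_esup (fun e : R => gamma x e E * (e^-1)%:E) 0^'+)%E.

Definition porous E := forall x, E x -> (0 < porosity E x)%E.

Definition sigma_porous E :=
  exists2 F : (set X)^nat, (forall i, porous (F i)) & E = \bigcup_i F i.

End porosity.

Section category.
Context {T : topologicalType}.
Implicit Types A : set T.

Definition nowhere_dense A := (closure A)° = set0.

Definition meager A :=
  exists2 F : (set T)^nat, (forall i, nowhere_dense (F i)) & A = \bigcup_i F i.

Definition comeager A := meager (~` A).

End category.

(* The interval [0, 1] as a type, with its subspace topology. *)
Definition unit_itv (R : realType) : Type := set_type `[0%R, 1%R : R]%classic.

HB.instance Definition _ (R : realType) := PseudoMetric.on (unit_itv R).

(* C[0,1]. Being a definition of its own, it does not receive the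
   (compact-open, product, ...) topologies the library puts on
   continuousType. *)
Definition C01 (R : realType) : Type := continuousType (unit_itv R) R.

HB.instance Definition _ (R : realType) := Choice.on (C01 R).

Section C01.
Context {R : realType}.
Local Notation I := (unit_itv R).
Implicit Types f g h : C01 R.

Definition C01_fun f : I -> R := (f : continuousType I R).
Local Coercion C01_fun : C01 >-> Funclass.

Lemma C01_continuous f : continuous (f : I -> R).
Proof. exact: (@cts_fun _ _ (f : continuousType I R)). Qed.

Definition C01_mk (f : I -> R) (cf : continuous f) : C01 R :=
  (mkcts cf : continuousType I R).

Lemma C01_eqP f g : (forall t, f t = g t) -> f = g.
Proof. by move=> fg; apply/(@continuousEP I R f g). Qed.

Fact C01_add_subproof f g : continuous (fun t => f t + g t).
Proof. by move=> t; apply: continuousD; exact: C01_continuous. Qed.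
Fact C01_opp_subproof f : continuous (fun t => - f t).
Proof. by move=> t; apply: continuousN; exact: C01_continuous. Qed.
Fact C01_scale_subproof (a : R) f : continuous (fun t => a * f t).
Proof.
by move=> t; apply: continuousM; [exact: cst_continuous|exact: C01_continuous].
Qed.
Fact C01_zero_subproof : continuous (fun _ : I => 0 : R).
Proof. exact: cst_continuous. Qed.

Definition C01_zero := C01_mk C01_zero_subproof.
Definition C01_add f g := C01_mk (@C01_add_subproof f g).
Definition C01_opp f := C01_mk (@C01_opp_subproof f).
Definition C01_scale a f := C01_mk (@C01_scale_subproof a f).

Fact C01_addA : associative C01_add.
Proof. by move=> f g h; apply: C01_eqP => t; exact: addrA. Qed.
Fact C01_addC : commutative C01_add.
Proof. by move=> f g; apply: C01_eqP => t; exact: addrC. Qed.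
Fact C01_add0 : left_id C01_zero C01_add.
Proof. by move=> f; apply: C01_eqP => t; exact: add0r. Qed.
Fact C01_addN : left_inverse C01_zero C01_opp C01_add.
Proof. by move=> f; apply: C01_eqP => t; exact: addNr. Qed.

HB.instance Definition _ :=
  GRing.isZmodule.Build (C01 R) C01_addA C01_addC C01_add0 C01_addN.

Fact C01_scaleA a b f : C01_scale a (C01_scale b f) = C01_scale (a * b) f.
Proof. by apply: C01_eqP => t; exact: mulrA. Qed.
Fact C01_scale1 : left_id 1 C01_scale.
Proof. by move=> f; apply: C01_eqP => t; exact: mul1r. Qed.
Fact C01_scaleDr : right_distributive C01_scale +%R.
Proof. by move=> a f g; apply: C01_eqP => t; exact: mulrDr. Qed.
Fact C01_scaleDl f : {morph C01_scale^~ f : a b / a + b}.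
Proof. by move=> a b; apply: C01_eqP => t; exact: mulrDl. Qed.

HB.instance Definition _ := GRing.Zmodule_isLmodule.Build R (C01 R)
  C01_scaleA C01_scale1 C01_scaleDr C01_scaleDl.

Definition C01_norm f : R := sup [set `|f t| | t in [set: I]].

Fact unit_itv0_subproof : (0 : R) \in `[0%R, 1%R : R]%classic.
Proof. by rewrite inE /= in_itv /= lexx ler01. Qed.
Definition unit_itv0 : I := exist _ 0 unit_itv0_subproof.

Lemma C01_has_sup f : has_sup [set `|f t| | t in [set: I]].
Proof.
apply: compact_has_sup; first by exists `|f unit_itv0|; exists unit_itv0.
pose F : R -> R := 'valL_0 (C01_fun f).
have FE : sigL `[0%R, 1%R : R]%classic F = C01_fun f by exact: valLK.
have cF : {within `[0, 1], continuous F}.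
  by apply/subspace_sigL_continuousP; rewrite FE; exact: C01_continuous.
rewrite (_ : [set _ | _ in _] = (fun x => `|F x|) @` `[0, 1]).
  apply: continuous_compact; last exact: segment_compact.
  by move=> x; apply: cvg_norm; exact: cF.
apply/seteqP; split => [_ [t _ <-]|_ [x x01 <-]].
  by exists (\val t); [exact: set_mem (valP t)|rewrite -FE].
by exists (exist _ x (mem_set x01)); rewrite // -FE.
Qed.

Lemma C01_norm_ub f t : `|f t| <= C01_norm f.
Proof. by apply: ub_le_sup; [case: (C01_has_sup f)|exists t]. Qed.

Lemma C01_norm_le f (c : R) : (forall t, `|f t| <= c) -> C01_norm f <= c.
Proof.
move=> fc; apply: ge_sup; first by case: (C01_has_sup f).
by move=> _ [t _ <-].
Qed.

Fact C01_norm_triangle f g : C01_norm (f + g) <= C01_norm f + C01_norm g.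
Proof.
apply: C01_norm_le => t; rewrite (le_trans (ler_normD _ _))//.
by rewrite lerD// C01_norm_ub.
Qed.

Fact C01_normZ (a : R) f : C01_norm (a *: f) = `|a| * C01_norm f.
Proof.
apply/eqP; rewrite eq_le; apply/andP; split.
  by apply: C01_norm_le => t; rewrite normrM ler_wpM2l// C01_norm_ub.
have [->|a0] := eqVneq a 0.
  by rewrite normr0 mul0r (le_trans _ (C01_norm_ub _ unit_itv0)).
rewrite mulrC -ler_pdivlMr ?normr_gt0//; apply: C01_norm_le => t.
rewrite ler_pdivlMr ?normr_gt0// mulrC -normrM.
exact: (C01_norm_ub (a *: f)).
Qed.

Fact C01_norm0_eq0 f : C01_norm f = 0 -> f = 0.
Proof.
move=> f0; apply: C01_eqP => t; apply/eqP; rewrite -normr_le0 -f0.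
exact: C01_norm_ub.
Qed.

HB.instance Definition _ := Lmodule_isNormed.Build R (C01 R)
  C01_norm_triangle C01_normZ C01_norm0_eq0.

Lemma C01_normE f : `|f| = sup [set `|f t| | t in [set: I]].
Proof. by []. Qed.

Definition C01_dist f g : R := `|g - f|.

Fact C01_dist_ge0 f g : 0 <= C01_dist f g. Proof. exact: normr_ge0. Qed.
Fact C01_dist_eq0 f g : C01_dist f g = 0 -> f = g.
Proof. by move=> /normr0_eq0/eqP; rewrite subr_eq0 => /eqP. Qed.
Fact C01_ball_dist f d : ball f d = [set g | C01_dist f g < d].
Proof. by rewrite -ball_normE; apply/seteqP; split => g /=; rewrite distrC. Qed.

HB.instance Definition _ := PseudoMetric_isMetric.Build R (C01 R)
  C01_dist_ge0 C01_dist_eq0 C01_ball_dist.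

Fact C01_complete (F : set_system (C01 R)) :
  ProperFilter F -> cauchy F -> cvg F.
Proof.
move=> FF /cauchy_ballP Fc.
pose A := arrow_uniform_type I R.
pose j : C01 R -> A := @C01_fun.
have jc : cauchy (j @ F).
  apply/cauchy_ballP => e e0; have := Fc _ e0.
  move=> [[P Q] [FP FQ] PQ]; exists (j @` P, j @` Q) => /=.
    by split; [apply: filterS FP|apply: filterS FQ] => f ?; exists f.
  move=> [_ _] [[f Pf <-] [g Qg <-]].
  have := PQ (f, g) (conj Pf Qg); rewrite -ball_normE /= => fg t.
  rewrite /ball /=.
  exact: le_lt_trans (C01_norm_ub (f - g) t) fg.
have /cvg_ex[g jg] : cvg (j @ F) by exact: cauchy_cvg.
have gc : continuous (g : I -> R).
  move=> t; apply/(@cvgrPdist_lt _ _ _ _ (nbhs_filter t)) => e e0.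
  have e3 : 0 < e / 3 by rewrite divr_gt0.
  have /(@filter_ex _ F)[f fg] : F [set f | ball g (e / 3) (j f)] :=
    jg _ (nbhsx_ballx g _ e3).
  have /(@cvgrPdist_lt _ _ _ _ (nbhs_filter t))/(_ _ e3) := @C01_continuous f t.
  apply: (@filterS _ _ (nbhs_filter t)) => s fts.
  have := fg t; have := fg s; rewrite /ball /= => gs gt.
  rewrite (_ : g t - g s = (g t - f t) + (f t - f s) + (f s - g s)); last first.
    by rewrite !addrA !subrK.
  rewrite (le_lt_trans (ler_normD _ _))//.
  rewrite (_ : e = e / 3 + e / 3 + e / 3); last by field.
  rewrite ltrD//; last by rewrite distrC.
  by rewrite (le_lt_trans (ler_normD _ _))// ltrD.
apply/cvg_ex; exists (C01_mk gc); apply/cvgrPdist_le => e e0.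
have : F [set f | ball g e (j f)] := jg _ (nbhsx_ballx g _ e0).
apply: filterS => f fg; apply: C01_norm_le => t.
by have := fg t; rewrite /ball /= => /ltW.
Qed.

HB.instance Definition _ := Uniform_isComplete.Build (C01 R) C01_complete.

(* [total_variation 0 1] takes a function on the whole line but only looks at
   its values on [0, 1]; the extension of f by 0 supplies one. *)
Definition C01_total_variation f : \bar R :=
  total_variation 0 1 ('valL_0 (C01_fun f)).

End C01.

Definition infinite_variation (R : realType) : set (C01 R) :=
  [set f | C01_total_variation f = +oo%E].

Arguments infinite_variation R : clear implicits.

(* Main.v *)
Require Import Defs.
From mathcomp Require Import all_boot all_order all_algebra.
From mathcomp Require Import lra.
From mathcomp Require Import all_classical all_reals all_analysis.
From mathcomp Require Import borel_hierarchy.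

(** The complement of [infinite_variation] is the increasing union of the closed
    sets of functions of variation at most [n].  Let [f] be in such a set and
    [e > 0], and put [g = f + (e/2) cos (N pi t)].  If [h] is within [e/4] of [g]
    then on the partition [k/N] the variation of [h] is at least
    [N e - N e / 2 - n], which exceeds [n] once [N e > 4 n].  So [ball g (e/4)]
    misses the set, at every scale [e]. *)

Set Implicit Arguments.
Unset Strict Implicit.
Unset Printing Implicit Defensive.

Import Order.TTheory GRing.Theory Num.Theory.
Import numFieldNormedType.Exports.

Local Open Scope ring_scope.
Local Open Scope classical_set_scope.

Section porosity.
Context {R : realType} {X : metricType R}.

(** A hole of relative size [c] at every scale keeps each quotient of [gamma x e E] by [e] at least
    [c], hence also their limsup. *)
Lemma porosity_gt0 (c : R) (E : set X) x : 0 < c ->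
  (forall e : R, 0 < e ->
    exists z, ball z (c * e) `<=` ball x e `\` E) ->
  (0 < porosity E x)%E.
Proof.
move=> c0 Ec; rewrite /porosity mule_gt0 ?lte_fin//.
apply: (@lt_le_trans _ _ c%:E); first by rewrite lte_fin.
(* The limsup is an infimum, over neighbourhoods [V], of suprema over [V]; a single [e > 0] in [V]
   already bounds the supremum below by [c]. *)
apply: le_ereal_inf_tmp => _ [V V0 <-].
have /= [e [Ve e0]] := @filter_ex _ (0 : R)^'+ _ _
  (filterI V0 (nbhs_right_gt (0 : R))).
have [z zE] := Ec _ e0.
apply: le_ereal_sup_tmp; exists (gamma x e E * (e^-1)%:E)%E; first by exists e.
rewrite -(mulfK (lt0r_neq0 e0) c) EFinM lee_pmul2r ?lte_fin ?invr_gt0//.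
rewrite /gamma le_max; apply/orP; right.
apply: ereal_sup_ubound; exists (c * e) => //; split; first exact: mulr_gt0.
by exists z.
Qed.

End porosity.

Section uniform_partition.
Context {R : realType}.

(** The indices start at 1 because [itv_partition] and [variation] themselves put the left endpoint
    in front of the list. *)
Definition uniform_partition (n : nat) : seq R :=
  [seq k%:R / n%:R | k <- iota 1 n].

Lemma nth_uniform_partition n k : (k <= n)%N ->
  nth 1 (0 :: uniform_partition n) k = k%:R / n%:R :> R.
Proof.
case: k => [|k] kn /=; first by rewrite mul0r.
by rewrite (nth_map 0%N) ?size_iota// nth_iota// add1n.
Qed.

Lemma itv_partition_uniform n : (0 < n)%N ->
  itv_partition (0 : R) 1 (uniform_partition n).
Proof.
move=> n0; split.
  (* The endpoint 0 is the image of the index 0, so monotonicity can be checked on the indices. *)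
  have := @path_map _ _ (fun k => k%:R / n%:R : R) <%R 0%N (iota 1 n).
  rewrite mul0r => ->; rewrite (@sub_path _ ltn) //; last exact: (iota_ltn_sorted 0 n.+1).
  by move=> i j ij /=; rewrite ltr_pM2r ?invr_gt0 ?ltr0n// ltr_nat.
rewrite (last_nth 1) size_map size_iota nth_uniform_partition//.
by rewrite divff// pnatr_eq0 -lt0n.
Qed.

End uniform_partition.

Section C01_variation.
Context {R : realType}.
Local Notation I := (unit_itv R).
Implicit Types (f g : C01 R) (s : seq R).

Definition C01_variation f s := variation 0 1 ('valL_0 (C01_fun f)) s.

Lemma C01_variationD f g s :
  C01_variation (f + g) s <= C01_variation f s + C01_variation g s.
Proof.
rewrite /C01_variation.
have -> : 'valL_0 (C01_fun (f + g)) =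
    ('valL_0 (C01_fun f) \+ 'valL_0 (C01_fun g))%R.
  apply/funext => x /=; rewrite /valL_/=.
  by case: ('oinv_set_val x) => //=; rewrite addr0.
exact: variation_le.
Qed.

Lemma C01_variationN f s : C01_variation (- f) s = C01_variation f s.
Proof.
rewrite /C01_variation -[RHS]variationN.
congr variation; apply/funext => x /=; rewrite /valL_/=.
by case: ('oinv_set_val x) => //=; rewrite oppr0.
Qed.

(** Each increment is at most twice the sup norm. With subadditivity, the variation along a fixed
    partition is therefore Lipschitz in the function. *)
Lemma C01_variation_norm_le f s :
  C01_variation f s <= (size s)%:R * (2 * `|f|).
Proof.
have fx x : `|'valL_0 (C01_fun f) x| <= `|f|.
  rewrite /valL_/=; case: ('oinv_set_val x) => /=; last by rewrite normr0.
  exact: C01_norm_ub.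
rewrite /C01_variation /variation.
apply: (@le_trans _ _ (\sum_(0 <= k < size s) (2 * `|f|))).
  apply: ler_sum => k _; apply: (le_trans (ler_normB _ _)).
  by rewrite mulr_natl mulr2n lerD //; exact: fx.
by rewrite sumr_const_nat subn0 -[leLHS]mulr_natl.
Qed.

Lemma C01_variation_le f s (c : R) : itv_partition 0 1 s ->
  (C01_total_variation f <= c%:E)%E -> C01_variation f s <= c.
Proof.
move=> s01 fc; rewrite -lee_fin (le_trans _ fc)//.
apply: ereal_sup_ubound; exists (C01_variation f s) => //.
exact: variations_variation.
Qed.

Lemma C01_total_variation_gtP f (c : R) : (c%:E < C01_total_variation f)%E ->
  exists2 s, itv_partition 0 1 s & c < C01_variation f s.
Proof.
move=> /ereal_sup_gt[_ [_ [s s01 <-] <-]]; rewrite lte_fin => cs.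
by exists s.
Qed.

(** Total variation is lower semicontinuous, as a supremum of continuous functionals: a partition on
    which [f] exceeds [c] serves every [g] near [f]. *)
Lemma closed_total_variation_le (c : R) :
  closed [set f : C01 R | (C01_total_variation f <= c%:E)%E].
Proof.
rewrite -openC openE => f /= /negP; rewrite -ltNge => /C01_total_variation_gtP.
move=> [s s01 cs]; rewrite /interior -nbhs_ballE.
(* Moving by less than [d] costs at most [(size s) * 2d], which is the excess over [c] minus [2d];
   the successor provides this margin and a nonzero denominator. *)
pose d : R := (C01_variation f s - c) / (2 * (size s).+1%:R).
have s0 : 0 < (size s).+1%:R :> R by rewrite ltr0n.
exists d => /=; first by rewrite divr_gt0 ?mulr_gt0// subr_gt0.
move=> g; rewrite -ball_normE /= => fg; apply/negP; rewrite -ltNge.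
have dE : d * (2 * (size s).+1%:R) = C01_variation f s - c.
  by rewrite divfK// gt_eqF// mulr_gt0.
have fgs : C01_variation f s <=
    C01_variation g s + (size s)%:R * (2 * `|f - g|).
  rewrite -[in leLHS](subrK g f) (le_trans (C01_variationD _ _ _))// addrC.
  by rewrite lerD2l C01_variation_norm_le.
rewrite ltNge; apply/negP => /(C01_variation_le s01) gc.
have : (size s)%:R * (2 * `|f - g|) <= (size s)%:R * (2 * d).
  by rewrite ler_wpM2l// ler_wpM2l// ltW.
have d0 : 0 < d by exact: le_lt_trans (normr_ge0 _) fg.
move: dE; rewrite -natr1; lra.
Qed.

Fact cosine_wave_subproof (n : nat) :
  continuous (fun t : I => cos (n%:R * pi * \val t : R)).
Proof.
move=> t; apply: continuous_comp; last exact: continuous_cos.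
apply: continuousM; first exact: cst_continuous.
exact: initial_continuous.
Qed.

Definition cosine_wave n : C01 R := C01_mk (@cosine_wave_subproof n).

Lemma cosine_wave_norm_le n : `|cosine_wave n| <= 1.
Proof. by apply: C01_norm_le => t; rewrite ler_norml cos_geN1 cos_le1. Qed.

Lemma cos_natpi k : cos (k%:R * pi) = (-1) ^+ k :> R.
Proof.
elim: k => [|k ih]; first by rewrite mul0r cos0.
by rewrite -natr1 mulrDl mul1r cosDpi ih exprS mulN1r.
Qed.

(** The values at the points [k/n] alternate between [a] and [-a], so all [n] increments have size
    [2|a|]. *)
Lemma cosine_wave_variation n (a : R) : (0 < n)%N ->
  C01_variation (a *: cosine_wave n) (uniform_partition n) =
  n%:R * (2 * `|a|).
Proof.
move=> n0; rewrite /C01_variation /variation size_map size_iota.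
have valE k : (k <= n)%N ->
    'valL_0 (C01_fun (a *: cosine_wave n)) (k%:R / n%:R) = a * (-1) ^+ k.
  move=> kn; have k01 : (k%:R / n%:R : R) \in `[0%R, 1%R : R]%classic.
    rewrite inE /= in_itv /= divr_ge0//= ler_pdivrMr ?ltr0n// mul1r.
    by rewrite ler_nat.
  (* At a point of [0, 1] the extension by 0 returns the original value. *)
  rewrite -(sigLE _ ('valL_0 _) _ k01) valLK /= -cos_natpi; congr (_ * cos _).
  by rewrite /= mulrAC mulrCA divff ?mulr1// pnatr_eq0 -lt0n.
transitivity (\sum_(0 <= k < n) (2 * `|a|)); last first.
  by rewrite sumr_const_nat subn0 -[LHS]mulr_natl.
rewrite !big_nat; apply: eq_bigr => k /andP[_ kn].
rewrite /comp !nth_uniform_partition ?valE//; try exact: ltnW.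
rewrite exprS mulN1r mulrN -opprD normrN -mulr2n normrMn normrM normrX.
by rewrite normrN1 expr1n mulr1 mulr_natl.
Qed.

Lemma total_variation_le_hole (c e : R) f : 0 < e ->
  (C01_total_variation f <= c%:E)%E ->
  exists z : C01 R, ball z (4^-1 * e) `<=`
    ball f e `\` [set g : C01 R | (C01_total_variation g <= c%:E)%E].
Proof.
(* This [n] is positive and gives [n e > 4|c| >= 4c]. *)
move=> e0 fc; pose n := (Num.truncn (4 * `|c| / e)).+1.
have nc : 4 * `|c| < n%:R * e by rewrite -ltr_pdivrMr// truncnS_gt.
have cc := ler_norm c.
pose w : C01 R := (e / 2) *: cosine_wave n.
have e2 : `|e / 2| = e / 2 by rewrite gtr0_norm// divr_gt0.
have w_le : `|w| <= e / 2.
  by rewrite normrZ e2 ler_piMr ?cosine_wave_norm_le// divr_ge0// ltW.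
exists (f + w) => g; rewrite -!ball_normE /= => wg; split.
  (* The distance from [f] to [g] is below [e/4 + e/2 < e]. *)
  have -> : f - g = (f + w - g) - w by rewrite addrAC addrK.
  have := ler_normB (f + w - g) w; lra.
pose s : seq R := uniform_partition n.
have s01 : itv_partition (0 : R) 1 s by exact: itv_partition_uniform.
move=> /(C01_variation_le s01) gs; have fs := C01_variation_le s01 fc.
have ws : C01_variation w s = n%:R * e.
  by rewrite cosine_wave_variation// e2 (mulrC 2) divfK.
have us := C01_variation_norm_le (f + w - g) s.
have : (size s)%:R * (2 * `|f + w - g|) <= n%:R * (2 * (4^-1 * e)).
  by rewrite size_map size_iota ler_wpM2l// ler_wpM2l// ltW.
have : C01_variation w s <=
    C01_variation g s + C01_variation f s + C01_variation (f + w - g) s.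
  have {1}-> : w = (g - f) + (f + w - g).
    by rewrite -[f + w - g]addrA (addrA (g - f)) subrK addrCA subrr addr0.
  rewrite (le_trans (C01_variationD _ _ _))// lerD2r.
  by rewrite (le_trans (C01_variationD _ _ _))// C01_variationN.
(* The bounds combine to [n e <= 2c + n e / 2], against [n e > 4c]. *)
lra.
Qed.

Lemma infinite_variationC :
  ~` infinite_variation R =
  \bigcup_n [set f : C01 R | (C01_total_variation f <= n%:R%:E)%E].
Proof.
apply/seteqP; split => [f /= fy|f [n _ /= fn] /= fy]; last first.
  by move: fn; rewrite fy leNgt ltry.
have : C01_total_variation f \is a fin_num.
  rewrite ge0_fin_numE ?total_variation_ge0// ltey; exact/eqP.
move=> /fineK fE; exists (Num.truncn (fine (C01_total_variation f))).+1 => //=.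
by rewrite -fE lee_fin ltW// truncnS_gt.
Qed.

(** The set is closed, so it suffices that no ball lies inside it: a ball around any of its points
    contains a hole, whose centre is outside the set. *)
Lemma nowhere_dense_total_variation_le (c : R) :
  nowhere_dense [set f : C01 R | (C01_total_variation f <= c%:E)%E].
Proof.
rewrite /nowhere_dense.
rewrite -(closure_id _).1; last exact: closed_total_variation_le.
apply/seteqP; split => // f; rewrite /interior -nbhs_ballE => -[e /= e0 fe].
have [z zf] := total_variation_le_hole e0 (fe _ (ballxx f e0)).
have [|/fe] := zf z; last by [].
by apply: ballxx; rewrite mulr_gt0// invr_gt0.
Qed.

End C01_variation.

Theorem theorem2p1 (R : realType) :
  Gdelta (infinite_variation R) /\ comeager (infinite_variation R) /\
  sigma_porous (~` infinite_variation R).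
Proof.
split; [|split].
- exists (fun n => ~` [set f : C01 R | (C01_total_variation f <= n%:R%:E)%E]).
    by move=> n; rewrite openC; exact: closed_total_variation_le.
  by rewrite -setC_bigcup -infinite_variationC setCK.
- rewrite /comeager infinite_variationC.
  eexists; last reflexivity.
  by move=> n; exact: nowhere_dense_total_variation_le.
- rewrite infinite_variationC.
  eexists; last reflexivity.
  move=> n f fn; apply: (@porosity_gt0 _ _ 4^-1); first by rewrite invr_gt0.
  by move=> e e0; exact: total_variation_le_hole.
Qed.
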